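(* Let $A$ be a finite alphabet, let $F\colon A^{\mathbb{Z}}\to A^{\mathbb{Z}}$ be a cellular automaton and let $\mu$ be a shift-ergodic Borel probability measure on $A^{\mathbb{Z}}$. If $F$ has some $\mu$-almost equicontinuous point, then the sequence $(\mu\circ F^{-n})_{n\in\mathbb{N}}$ converges vaguely in Cesàro mean to an $F$-invariant probability measure $\mu_c$; that is, there is an $F$-invariant Borel probability measure $\mu_c$ on $A^{\mathbb{Z}}$ such that $\frac1n\sum_{i=0}^{n-1}\mu\circ F^{-i}\to\mu_c$ vaguely (equivalently, weak-$*$) as $n\to\infty$.
   Context: $A^{\mathbb{Z}}$ carries the product topology of the discrete topology on the finite set $A$. The shift is $\sigma(x)=(x_{i+1})_{i\in\mathbb{Z}}$. A cellular automaton is a continuous map $F\colon A^{\mathbb{Z}}\to A^{\mathbb{Z}}$ commuting with $\sigma$. A measure is shift-ergodic if it is $\sigma$-invariant and ergodic for $\sigma$. It is $F$-invariant if $\mu\circ F^{-1}=\mu$. For $n\in\mathbb{N}$ ($\mathbb{N}$ contains $0$) and $x\in A^{\mathbb{Z}}$ put $C_n(x)=\{y: y_j=x_j \text{ for } -n\le j\le n\}$ and $B_n(x)=\{y: F^i(y)_j=F^i(x)_j \text{ for all } i\in\mathbb{N} \text{ and } -n\le j\le n\}$. A point $x$ is $\mu$-almost equicontinuous (also called $\mu$-equicontinuous) for $F$ if for all $m\in\mathbb{N}$, $\lim_{n\to\infty}\mu(C_n(x)\cap B_m(x))/\mu(C_n(x))=1$ (in particular $\mu(C_n(x))>0$ for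 all $n$). *)

(* Defs.v *)
From HB Require Import structures.
From mathcomp Require Import all_boot all_order all_algebra.
From mathcomp Require Import all_classical all_reals all_analysis.

Set Implicit Arguments.
Unset Strict Implicit.
Unset Printing Implicit Defensive.

Import Order.TTheory GRing.Theory Num.Theory.
Import numFieldNormedType.Exports.

Local Open Scope classical_set_scope.
Local Open Scope ring_scope.

(* The alphabet is a [pointedType] because measurable types are pointed in
   MathComp-Analysis; its finiteness is a hypothesis of the theorem. *)
Definition config (A : pointedType) : Type :=
  prod_topology (fun _ : int => discrete_topology A).

HB.instance Definition _ (A : pointedType) := Pointed.on (config A).
HB.instance Definition _ (A : pointedType) := Uniform.on (config A).

Definition config_open (A : pointedType) : set (set (config A)) := open.

(* Borel sigma-algebra of the product topology *)
HB.instance Definition _ (A : pointedType) :=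
  Measurable.copy (config A) (g_sigma_algebraType (@config_open A)).

Section cellular_automata.
Variable A : pointedType.
Implicit Types (F : config A -> config A) (x : config A) (n : nat).

Definition shift_map x : config A := fun i : int => x (i + 1).

Definition cellular_automaton F : Prop :=
  continuous F /\ forall x, F (shift_map x) = shift_map (F x).

Definition C_ n x : set (config A) :=
  [set y | forall j : int, - n%:Z <= j <= n%:Z -> y j = x j].

Definition B_ F n x : set (config A) :=
  [set y | forall (i : nat) (j : int),
    - n%:Z <= j <= n%:Z -> iter i F y j = iter i F x j].

End cellular_automata.

Section measures.
Context d (T : measurableType d) (R : realType).
Implicit Types (mu : set T -> \bar R) (f : T -> T).

Definition invariant_measure f mu : Prop :=
  forall B, measurable B -> pushforward mu f B = mu B.

Definition ergodic_measure f mu : Prop :=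
  invariant_measure f mu /\
  forall B, measurable B -> f @^-1` B = B -> mu B = 0%E \/ mu B = 1%E.

(* For n = 0 this is the zero measure, as 0^-1 = 0. *)
Definition cesaro_mean f mu (n : nat) : set T -> \bar R :=
  fun B => ((n%:R^-1 : R)%:E * \sum_(i < n) pushforward mu (iter i f) B)%E.

End measures.

Section convergence.
Variables (A : pointedType) (R : realType).

(* Test functions are the continuous functions with compact support; for a
   finite alphabet [config A] is compact and these are all the continuous
   functions, so that this is also weak-* convergence. *)
Definition vague_cvg (nu : nat -> set (config A) -> \bar R)
    (nu_lim : set (config A) -> \bar R) : Prop :=
  forall f : config A -> R,
    continuous f -> compact (closure [set x | f x != 0]) ->
    (\int[nu n]_x (f x)%:E)%E @[n --> \oo] --> (\int[nu_lim]_x (f x)%:E)%E.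

Definition almost_equicontinuous_point (mu : set (config A) -> \bar R)
    (F : config A -> config A) (x : config A) : Prop :=
  (forall n, (0 < mu (C_ n x))%E) /\
  forall m, fine (mu (C_ n x `&` B_ F m x)) / fine (mu (C_ n x))
              @[n --> \oo] --> (1 : R).

End convergence.

(* Main.v *)
(* Let r be the radius of F, x an equicontinuous point, and E = B_m(x) with
   m >= r, which has positive measure. By ergodicity almost every y visits E
   arbitrarily far to the right and to the left. Two such visits enclose a window
   whose two boundary blocks both follow the orbit of x, hence agree forever and
   isolate the window from the outside: the F-orbit of y seen through the window
   is eventually periodic. Therefore the Cesaro means of the indicator of any
   clopen set along the orbit of y converge, and by dominated convergence so do
   the Cesaro means of mu on clopen sets. By compactness the limit is countably
   additive on the algebra of clopen sets, so Caratheodory's theorem extends it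
   to mu_c. Invariance holds because the n-th means of U and F^-1(U) differ by at
   most 1/n, and vague convergence because continuous functions are uniform limits
   of functions depending on finitely many coordinates. *)

Require Import Defs.
From HB Require Import structures.
From mathcomp Require Import all_boot all_order all_algebra.
From mathcomp Require Import all_classical all_reals all_analysis.
From mathcomp Require Import measurable_realfun.
From mathcomp Require Import finmap zify ring lra.

Set Implicit Arguments.
Unset Strict Implicit.
Unset Printing Implicit Defensive.

Import Order.TTheory GRing.Theory Num.Theory.
Import numFieldNormedType.Exports.

Local Open Scope fset_scope.
Local Open Scope classical_set_scope.
Local Open Scope ring_scope.

(** * Cylinders, clopen sets and compactness of the configuration space *)

Section config_topology.
Variable A : pointedType.
Implicit Types (x y z : config A) (n : nat).

Lemma C_refl n x : C_ n x x.
Proof. by []. Qed.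

Lemma C_sym n x y : C_ n x y -> C_ n y x.
Proof. by move=> xy j jn; rewrite xy. Qed.

Lemma C_trans n x y z : C_ n x y -> C_ n y z -> C_ n x z.
Proof. by move=> xy yz j jn; rewrite yz ?xy. Qed.

Lemma subset_C_ m n x : (m <= n)%N -> C_ n x `<=` C_ m x.
Proof. by move=> mn y xy j jm; apply: xy; lia. Qed.

Lemma eval_continuous (i : int) :
  continuous (fun x => x i : discrete_topology A).
Proof. exact: (@proj_continuous int (fun _ => discrete_topology A) i). Qed.

(** The product topology is the supremum of the initial topologies of the coordinate maps. So it
    suffices that the filter of cylinders refines each of these, and [C_ n x] fixes coordinate [i]
    as soon as [n] is at least [|i|]. *)
Lemma nbhs_C_ x (U : set (config A)) :
  nbhs x U -> exists n, C_ n x `<=` U.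
Proof.
pose G := filter_from [set: nat] (fun n => C_ n x).
have FG : Filter G.
  apply: filter_from_filter; first by exists 0%N.
  move=> m n _ _; exists (maxn m n) => // y xy.
  by split; apply: (subset_C_ _ xy); rewrite (leq_maxl, leq_maxr).
suff : G --> x by move=> /[apply] -[n _ nU]; exists n.
apply/cvg_sup => i V.
rewrite (@nbhsE (initial_topology
  (fun f : (forall _ : int, discrete_topology A) => f i))).
move=> [_ [[W oW <-]] Wx] WV.
by exists `|i|%N => // y xy; apply: WV; rewrite /= xy//; lia.
Qed.

Lemma eval_clopen (i : int) (P : set A) : clopen [set x : config A | P (x i)].
Proof.
apply: (@preimage_clopen _ _ (fun x : config A => x i : discrete_topology A)).
  by split; [exact: discrete_open|exact: discrete_closed].
exact: eval_continuous.
Qed.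

Lemma C_closed n x : closed (C_ n x).
Proof.
rewrite (_ : C_ n x =
    \bigcap_(j in [set j : int | - n%:Z <= j <= n%:Z]) [set y | [set x j] (y j)]).
  by apply: closed_bigI => j _; exact: (eval_clopen _ _).2.
by apply/seteqP; split.
Qed.

Lemma C_open n x : open (C_ n x).
Proof.
rewrite (_ : C_ n x =
  \bigcap_(j in [set` [fset j in [seq k%:Z - n%:Z | k <- iota 0 (n + n).+1]]])
     [set y | [set x j] (y j)]).
  rewrite openE => y xy; apply: filter_bigI => j jD.
  by apply: open_nbhs_nbhs; split; [exact: (eval_clopen _ _).1|exact: xy].
set s := map _ _; apply/seteqP; split => [y xy j /=|y xy j jn].
  rewrite in_fset => /seq.mapP[k]; rewrite mem_iota => kn ->; apply: xy; lia.
apply: (xy j) => /=; rewrite in_fset; apply/seq.mapP; exists (absz (j + n%:Z)).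
  by rewrite mem_iota; lia.
by lia.
Qed.

Lemma clopen_C_ n x : clopen (C_ n x).
Proof. by split; [exact: C_open|exact: C_closed]. Qed.

Hypothesis finA : finite_set [set: A].

Lemma config_compact : compact [set: config A].
Proof.
have := @tychonoff int (fun=> discrete_topology A) (fun=> setT)

  (fun=> @finite_compact (discrete_topology A) setT finA).
by congr compact; apply/seteqP.
Qed.

(** A Lebesgue number argument: finitely many cylinders [C_ (n x) x] cover the space, and the
    largest of their [n x] serves everywhere. *)
Lemma uniformly_C_ (Q : config A -> config A -> Prop) :
  (forall x, exists n, forall y z, C_ n x y -> C_ n x z -> Q y z) ->
  exists n, forall y z, C_ n y z -> Q y z.
Proof.
move=> /choice[n nQ].
have := config_compact; rewrite compact_cover => /(_ _ setT (fun x => C_ (n x) x)).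
case=> [x _|x _|D _ DT]; first exact: C_open.
  by exists x.
exists (\max_(x <- enum_fset D) n x) => y z yz.
have [x xD xy] := DT y I; apply: (nQ x) => //; apply: (C_trans xy).
by apply: (subset_C_ _ yz); exact: leq_bigmax_seq.
Qed.

Lemma clopen_uniform (U : set (config A)) : clopen U ->
  exists n, forall y z, C_ n y z -> U y <-> U z.
Proof.
move=> [oU cU]; apply: uniformly_C_ => x; have [xU|xU] := pselect (U x).
  have [n nU] : exists n, C_ n x `<=` U.
    by apply: nbhs_C_; exact: open_nbhs_nbhs.
  by exists n => y z /nU Uy /nU Uz; split.
have [n nU] : exists n, C_ n x `<=` ~` U.
  by apply: nbhs_C_; apply: open_nbhs_nbhs; split=> //; exact: closed_openC.
by exists n => y z /nU Uy /nU Uz; split.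
Qed.

End config_topology.

(** * Integer powers of the shift, and continuity read off cylinders *)

Definition shiftz (A : pointedType) (k : int) (x : config A) : config A :=
  fun i => x (i + k).

Definition eventually_periodic (T : Type) (u : nat -> T) :=
  exists n p, (0 < p)%N /\ forall i, (n <= i)%N -> u (i + p)%N = u i.

Section shift.
Variable A : pointedType.
Implicit Types (x y z : config A) (k : int).

Lemma shiftzD k l x : shiftz k (shiftz l x) = shiftz (k + l) x.
Proof. by apply/funext => i; rewrite /shiftz addrA. Qed.

Lemma shiftz0 x : shiftz 0 x = x.
Proof. by apply/funext => i; rewrite /shiftz addr0. Qed.

Lemma shiftz_nat (n : nat) x : shiftz n%:Z x = iter n (@shift_map A) x.
Proof.
elim: n => [|n IHn]; first exact: shiftz0.
by rewrite iterS -IHn -[shift_map _]/(shiftz 1 _) shiftzD -PoszD add1n.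
Qed.

Lemma continuous_C_ (f : config A -> config A) :
  (forall n x, exists m, forall y, C_ m x y -> C_ n (f x) (f y)) ->
  continuous f.
Proof.
move=> fC x; move=> U /nbhs_C_[n nU]; have [m mn] := fC n x.
apply: (@filterS _ (nbhs x) _ (C_ m x)); first by move=> y /mn /nU.
by apply: open_nbhs_nbhs; split; [exact: C_open|exact: C_refl].
Qed.

Lemma shiftz_continuous k : continuous (@shiftz A k).
Proof.
apply: continuous_C_ => n x; exists (n + absz k)%N => y xy j jn.
by rewrite /shiftz xy//; lia.
Qed.

End shift.

(** * Local rules and windows isolated from the outside *)

Section orbits.
Variables (A : pointedType) (F : config A -> config A).
Hypothesis caF : cellular_automaton F.
Implicit Types (x y z : config A) (k : int).

Lemma shiftz_ca k x : F (shiftz k x) = shiftz k (F x).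
Proof.
have Fnat (n : nat) y : F (shiftz n%:Z y) = shiftz n%:Z (F y).
  by rewrite !shiftz_nat; elim: n => //= n IHn; rewrite caF.2 IHn.
case: k => n //; rewrite NegzE -[in RHS](shiftz0 x).
by rewrite -(subrr n.+1%:Z) -shiftzD Fnat shiftzD addNr shiftz0.
Qed.

Lemma shiftz_iter_ca k x i : iter i F (shiftz k x) = shiftz k (iter i F x).
Proof. by elim: i => //= i ->; rewrite shiftz_ca. Qed.

Hypothesis finA : finite_set [set: A].

(** The Curtis-Hedlund-Lyndon theorem: uniform continuity gives the radius at coordinate 0, and
    commutation with the shift carries it to every [j]. *)
Lemma ca_radius : exists r : nat, forall y z (j : int),
  (forall k, - r%:Z <= k <= r%:Z -> y (j + k) = z (j + k)) -> F y j = F z j.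
Proof.
have [x|r rF] := uniformly_C_ finA (Q := fun y z => F y 0 = F z 0).
  have [|n nF] := @nbhs_C_ A x (F @^-1` [set y | y 0 = F x 0]).
    apply: (caF.1 x); apply: open_nbhs_nbhs; split=> //.
    exact: (eval_clopen _ [set F x 0]).1.
  by exists n => y z /nF/= -> /nF/= ->.
exists r => y z j yz; have := rF (shiftz j y) (shiftz j z).
rewrite !shiftz_ca /shiftz add0r; apply => k kr.
by rewrite addrC yz.
Qed.

(** By compactness the sequence has a cluster point, whose [n]-cylinder it visits infinitely
    often. *)
Lemma pigeonhole_C_ n (u : nat -> config A) :
  exists i j, (i < j)%N /\ C_ n (u i) (u j).
Proof.
have [|x [_ ux]] := config_compact finA (F := u @ \oo); first exact: filterT.
have C_x : nbhs x (C_ n x).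
  by apply: open_nbhs_nbhs; split; [exact: C_open|exact: C_refl].
have uxN N : exists i, (N <= i)%N /\ C_ n x (u i).
  have [|_ [[i Ni <-] xi]] := ux (u @` [set i | (N <= i)%N]) _ _ C_x.
    by exists N => // i /= Ni; exists i.
  by exists i.
have [i [_ xi]] := uxN 0%N; have [j [ij xj]] := uxN i.+1.
by exists i, j; split=> //; exact: C_trans (C_sym xi) xj.
Qed.

(* If the blocks around [a] and [b] agree forever, the window between them
   evolves autonomously, hence is eventually periodic by the pigeonhole
   principle. *)
Lemma window_eventually_periodic : exists m0 : nat, forall (m : nat) y (a b : int),
  (m0 <= m)%N -> a + m%:Z < b ->
  (forall i k, - m%:Z <= k <= m%:Z -> iter i F y (a + k) = iter i F y (b + k)) ->
  exists N p, (0 < p)%N /\ forall i j, (N <= i)%N -> a <= j < b ->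
    iter (i + p) F y j = iter i F y j.
Proof.
have [r rF] := ca_radius; exists r => m y a b rm ab yab.
(* The neighbourhood of a cell of the window overshoots it by at most [r <= m] cells. An
   overshooting cell lies in the block around [a] or [b], and its twin in the other block lies
   inside the window because [a + m < b]. *)
have step i i' : (forall j, a <= j < b -> iter i F y j = iter i' F y j) ->
    forall j, a <= j < b -> iter i.+1 F y j = iter i'.+1 F y j.
  move=> ii' j abj /=; apply: rF => k kr; set l := j + k.
  have [la|al] := ltP l a.
    have -> : l = a + (l - a) by lia.
    by rewrite !yab ?ii'//; lia.
  have [lb|bl] := ltP l b; first by rewrite ii'//; lia.
  have -> : l = b + (l - b) by lia.
  by rewrite -!yab ?ii'//; lia.
(* The radius [absz a + absz b] makes the cylinder cover the whole window. *)
have [i [i' [ii' yii']]] := pigeonhole_C_ (absz a + absz b) (fun i => iter i F y).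
exists i, (i' - i)%N; split=> [|l j il]; first by rewrite subn_gt0.
rewrite -(subnKC il); elim: (l - i)%N j => [|t IHt] j abj.
  by rewrite addn0 subnKC 1?ltnW//; apply: yii'; lia.
rewrite addnS addSn; exact: step.
Qed.

End orbits.

(** * Cesaro means of eventually periodic sequences *)

Section cesaro_periodic.
Variable R : realType.
Implicit Types u : nat -> R.

(** Every value already occurs among the first [N + p] terms. *)
Lemma eventually_periodic_bounded u : eventually_periodic u ->
  exists M, forall n, `|u n| <= M.
Proof.
move=> [N [p [p0 up]]]; exists (\sum_(i < N + p) `|u i|) => n.
have [i -> ] : exists i : 'I_(N + p), u n = u i.
  elim/ltn_ind: n => n IHn; have [nNp|Npn] := ltnP n (N + p).
    by exists (Ordinal nNp).
  have [|i ui] := IHn (n - p)%N; first by lia.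
  by exists i; rewrite -ui -[in LHS](@subnK p n) ?up//; lia.
by rewrite (bigD1 i)//= lerDl sumr_ge0.
Qed.

(** The limit is the mean [c] over one period. The defect [w n] of the partial sums from [n * c] is
    again eventually periodic, hence bounded, and vanishes after division by [n]. *)
Lemma cvg_cesaro_eventually_periodic u : eventually_periodic u ->
  cvgn (fun n => n%:R^-1 * \sum_(i < n) u i).
Proof.
move=> [N [p [p0 up]]]; pose c := p%:R^-1 * \sum_(N <= i < N + p) u i.
have sumE n : (N <= n)%N -> \sum_(n <= i < n + p) u i = p%:R * c.
  move=> Nn; rewrite mulrA divff ?mul1r ?pnatr_eq0 -?lt0n//.
  rewrite -(subnKC Nn); elim: (n - N)%N => [|k IHk]; first by rewrite addn0.
  rewrite -IHk addnS addSn big_nat_recr/=; last by lia.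
  by rewrite [RHS]big_ltn ?up 1?addrC ?leq_addr//; lia.
pose w n := \sum_(i < n) u i - n%:R * c.
have [M wM] : exists M, forall n, `|w n| <= M.
  apply: eventually_periodic_bounded; exists N, p; split=> // n Nn.
  rewrite /w -!(big_mkord xpredT u) (big_cat_nat _ (leq_addr p n))//= sumE//.
  by rewrite natrD mulrDl; ring.
apply/cvg_ex; exists c; rewrite -[X in _ --> X]addr0.
apply: (@cvg_trans _ ((fun n => c + n%:R^-1 * w n) @ \oo)).
  apply: near_eq_cvg; near=> n.
  have n0 : n%:R != 0 :> R by rewrite pnatr_eq0 -lt0n; near: n; exact: nbhs_infty_gt.
  by rewrite /w; field.
apply: cvgD; first exact: cvg_cst.
apply/cvgr0Pnorm_lt => e e0; near=> n.
have n0 : 0 < n%:R :> R by rewrite ltr0n; near: n; exact: nbhs_infty_gt.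
rewrite normrM normfV (ger0_norm (ltW n0)) mulrC ltr_pdivrMr//.
apply: (le_lt_trans (wM n)); rewrite mulrC -ltr_pdivrMr//.
by near: n; exact: nbhs_infty_gtr.
Unshelve. all: end_near. Qed.

End cesaro_periodic.

(** * Infinitely many visits under an ergodic map *)

Section recurrence.
Context d (T : measurableType d) (R : realType) (P : probability T R).
Implicit Types (E : set T) (f : T -> T).

(** The limsup set is the decreasing intersection of the tail unions, each of measure at least
    [c]. *)
Lemma probability_lim_sup_set_ge (c : \bar R) (E_ : nat -> set T) :
  (forall n, measurable (E_ n)) -> (forall n, (c <= P (E_ n))%E) ->
  (c <= P (lim_sup_set E_))%E.
Proof.
move=> mE cE.
have mU n : measurable (\bigcup_(k in [set k | (n <= k)%N]) E_ k).
  exact: bigcup_measurable.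
have cvgE := lim_sup_set_cvg P E_ mE (le_lt_trans (probability_le1 P (mU 0%N)) (ltry 1)).
rewrite -(cvg_lim _ cvgE)//; apply: lime_ge; first by apply/cvg_ex; eexists; exact: cvgE.
apply: nearW => n; apply: (le_trans (cE n)); apply: le_measure.
- exact: mem_set.
- exact: mem_set.
- by move=> x Ex; exists n => /=.
Qed.

Lemma measurable_lim_sup_set (E_ : nat -> set T) :
  (forall n, measurable (E_ n)) -> measurable (lim_sup_set E_).
Proof. by move=> mE; apply: bigcapT_measurable => n; exact: bigcup_measurable. Qed.

(** The limsup set is invariant and has measure at least [P E > 0], hence measure 1. The family [g]
    is kept apart from [f] so that forward and backward visits are both covered by the ergodicity of
    one map. *)
Lemma ergodic_recurrence f E (g : nat -> T -> T) :
  ergodic_measure f P -> measurable E -> (0 < P E)%E ->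
  (forall n, measurable_fun setT (g n)) ->
  (forall n, P (g n @^-1` E) = P E) ->
  f @^-1` lim_sup_set (fun n => g n @^-1` E) =
    lim_sup_set (fun n => g n @^-1` E) ->
  {ae P, forall x, forall N, exists2 n, (N <= n)%N & E (g n x)}.
Proof.
move=> ergf mE E0 mg PgE fD; set D := lim_sup_set _ in fD.
have mgE n : measurable (g n @^-1` E) by rewrite -[X in measurable X]setTI; exact: mg.
have mD : measurable D by exact: measurable_lim_sup_set.
have PD : P D = 1%E.
  have [D0|//] := ergf.2 _ mD fD.
  have : (P E <= P D)%E by apply: probability_lim_sup_set_ge => // n; rewrite PgE.
  by rewrite D0 leNgt E0.
exists (~` D); split; first exact: measurableC.
  by rewrite probability_setC// PD subee.
move=> x; apply: contra_not => Dx N; have [n /= Nn] := Dx N I.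
by exists n.
Qed.

End recurrence.

(** * Borel measurability of cylinders, continuous maps and the sets [B_] *)

Section config_measurability.
Variable A : pointedType.
Implicit Types (U : set (config A)) (F : config A -> config A).

Lemma open_config_measurable U : open U -> measurable U.
Proof. by move=> oU; apply: sub_sigma_algebra. Qed.

Lemma closed_config_measurable U : closed U -> measurable U.
Proof.
move=> cU; rewrite -[U]setCK; apply: measurableC.
by apply: open_config_measurable; exact: closed_openC.
Qed.

Lemma clopen_config_measurable U : clopen U -> measurable U.
Proof. by move=> [oU _]; exact: open_config_measurable. Qed.

Lemma continuous_config_measurable F : continuous F -> measurable_fun setT F.
Proof.
move=> cF; apply: (measurability (@config_open A) erefl) => //.
move=> _ [U oU <-]; rewrite setTI; apply: open_config_measurable.
by apply: open_comp => // x _; exact: cF.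
Qed.

Lemma continuous_config_measurable_real (R : realType) (f : config A -> R) :
  continuous f -> measurable_fun setT f.
Proof.
move=> cf; apply: (measurability _ (RGenOpens.measurableE R)).
move=> _ [_ [a [b ->]] <-]; rewrite setTI; apply: open_config_measurable.
by apply: open_comp => // x _; exact: cf.
Qed.

Lemma iter_continuous F : continuous F -> forall i, continuous (iter i F).
Proof.
move=> cF; elim=> [|i IHi] x; first exact: cvg_id.
exact: (continuous_comp (IHi x) (cF _)).
Qed.

Lemma C_measurable n (x : config A) : measurable (C_ n x).
Proof. by apply: clopen_config_measurable; exact: clopen_C_. Qed.

Lemma B_closed F : continuous F -> forall n x, closed (B_ F n x).
Proof.
move=> cF n x; rewrite (_ : B_ F n x =
    \bigcap_i (iter i F @^-1` C_ n (iter i F x))).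
  apply: closed_bigI => i _; apply: preimage_closed; last exact: C_closed.
  by move=> y _; exact: iter_continuous.
by apply/seteqP; split => [y xy i _ j jn|y xy i j jn]; [exact: xy|exact: (xy i)].
Qed.

Lemma B_measurable F : continuous F -> forall n x, measurable (B_ F n x).
Proof.
by move=> cF n x; apply: closed_config_measurable; exact: B_closed.
Qed.

End config_measurability.

(** * Convergence of the Cesaro means on clopen sets *)

Section almost_equicontinuity.
Variables (A : pointedType) (R : realType) (mu : probability (config A) R).
Hypothesis erg_mu : ergodic_measure (@shift_map A) mu.
Implicit Types (E : set (config A)).

Lemma measurable_shiftz k : measurable_fun setT (@shiftz A k).
Proof. by apply: continuous_config_measurable; exact: shiftz_continuous. Qed.

Lemma measurable_preimage_shiftz k E : measurable E -> measurable (shiftz k @^-1` E).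
Proof. by move=> mE; rewrite -[X in measurable X]setTI; exact: measurable_shiftz. Qed.

Lemma shiftz_invariant k E : measurable E -> mu (shiftz k @^-1` E) = mu E.
Proof.
have shiftn (n : nat) B : measurable B -> mu (shiftz n%:Z @^-1` B) = mu B.
  elim: n B => [|n IHn] B mB.
    by congr (mu _); apply/seteqP; split => x /=; rewrite shiftz0.
  rewrite -[RHS](erg_mu.1 _ mB) /pushforward -[RHS]IHn; last first.
    exact: (measurable_preimage_shiftz 1).
  congr (mu _); apply/seteqP; split => x /=;
    by rewrite -[shift_map _]/(shiftz 1 _) shiftzD -PoszD add1n.
move=> mE; case: k => n; first exact: (shiftn n E mE).
(* A negative power is undone by the corresponding positive one, which preserves [mu]. *)
rewrite NegzE -[LHS](shiftn n.+1 _ (measurable_preimage_shiftz _ mE)).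
by congr (mu _); apply/seteqP; split => x /=; rewrite shiftzD addNr shiftz0.
Qed.

Lemma shiftz_recurrence E : measurable E -> (0 < mu E)%E ->
  {ae mu, forall y, forall N, (exists2 n, (N <= n)%N & E (shiftz n%:Z y)) /\
                              (exists2 n, (N <= n)%N & E (shiftz (- n%:Z) y))}.
Proof.
move=> mE E0.
have fwd : {ae mu, forall y, forall N, exists2 n, (N <= n)%N & E (shiftz n%:Z y)}.
  apply: (ergodic_recurrence erg_mu mE E0) => [n|n|]; first exact: measurable_shiftz.
    exact: shiftz_invariant.
  have sh n y : shiftz n%:Z (shift_map y) = shiftz n.+1%:Z y.
    by rewrite -[shift_map _]/(shiftz 1 _) shiftzD (_ : n%:Z + 1 = n.+1%:Z)//; lia.
  (* Passing between [y] and [shift_map y] moves the index by one, so a visit after [N.+1] is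
     requested. *)
  apply/seteqP; split=> y Dy N _; have [n /= Nn] := Dy N.+1 I.
    by rewrite sh => En; exists n.+1 => //=; exact: leqW (ltnW Nn).
  by case: n Nn => // n Nn; rewrite -sh => En; exists n.
have bwd : {ae mu, forall y, forall N, exists2 n, (N <= n)%N & E (shiftz (- n%:Z) y)}.
  apply: (@ergodic_recurrence _ _ _ _ _ _
    (fun n => shiftz (- n%:Z)) erg_mu mE E0) => [n|n|].
  - exact: measurable_shiftz.
  - exact: shiftz_invariant.
  have sh n y : shiftz (- n.+1%:Z) (shift_map y) = shiftz (- n%:Z) y.
    by rewrite -[shift_map _]/(shiftz 1 _) shiftzD (_ : _ + 1 = - n%:Z)//; lia.
  apply/seteqP; split=> y Dy N _; have [n /= Nn] := Dy N.+1 I.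
    by case: n Nn => // n Nn; rewrite sh => En; exists n.
  by rewrite -sh => En; exists n.+1 => //=; exact: leqW (ltnW Nn).
by apply: filterS2 fwd bwd => y fy by_ N; split; [exact: fy|exact: by_].
Qed.

Hypothesis finA : finite_set [set: A].
Variable F : config A -> config A.
Hypothesis caF : cellular_automaton F.
Variable x : config A.
Hypothesis eqx : almost_equicontinuous_point mu F x.

(** Otherwise all the ratios in the definition of an almost equicontinuous point would be 0 and
    could not tend to 1. *)
Lemma measure_B_gt0 m : (0 < mu (B_ F m x))%E.
Proof.
have mB := B_measurable caF.1 m x.
rewrite lt0e measure_ge0 andbT; apply/eqP => B0.
have := eqx.2 m; rewrite (_ : (fun n => _) = fun=> 0).
  move=> /(cvg_unique (@Rhausdorff R))/(_ (cvg_cst 0)) /eqP.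
  by rewrite oner_eq0.
apply/funext => n; rewrite (_ : mu _ = 0%E) ?mul0r//.
apply/eqP; rewrite -measure_le0 -B0; apply: le_measure.
- by apply: mem_set; apply: measurableI => //; exact: C_measurable.
- exact: mem_set.
- exact: subIsetr.
Qed.

Lemma ae_window_eventually_periodic :
  {ae mu, forall y, forall n, exists N p, (0 < p)%N /\
    forall i, (N <= i)%N -> C_ n (iter i F y) (iter (i + p) F y)}.
Proof.
have [m mP] := window_eventually_periodic caF finA.
have mB := B_measurable caF.1 m x.
apply: filterS (shiftz_recurrence mB (measure_B_gt0 m)) => y yB n.
(* Visits at distance at least [n + m + 1] on either side make the window from [-q] to [p] contain
   the coordinates from [-n] to [n] and be longer than [m]. *)
have [[p np Bp] [q nq Bq]] := yB (n + m.+1)%N.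
have [||N [t [t0 per]]] := mP m y (- q%:Z) p%:Z (leqnn _).
- by lia.
- move=> i k km; have := Bp i k km; have := Bq i k km.
  by rewrite !shiftz_iter_ca// /shiftz addrC => ->; rewrite addrC => ->.
exists N, t; split=> // i Ni j jn; apply: per => //; lia.
Qed.

Lemma cvg_cesaro_clopen (U : set (config A)) : clopen U ->
  cvgn (fun n => cesaro_mean F mu n U).
Proof.
move=> cU; have mU := clopen_config_measurable cU.
have mF i : measurable_fun setT (iter i F).
  by apply: continuous_config_measurable; apply: iter_continuous; exact: caF.1.
have mFU i : measurable (iter i F @^-1` U).
  by rewrite -[X in measurable X]setTI; exact: mF.
(* The mean of [U] is the integral of the time average [h n], so almost everywhere convergence of
   [h] and the bound 1 suffice. *)
pose h n y : R := n%:R^-1 * \sum_(i < n) \1_U (iter i F y).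
have mh n : measurable_fun setT (h n).
  apply: measurable_funM => //; apply: measurable_sum => i.
  exact: (measurable_indic (mFU i)).
have hE n y : (h n y)%:E =
    ((n%:R^-1)%:E * \sum_(i < n) (\1_(iter i F @^-1` U) y)%:E)%E.
  by rewrite /h EFinM sumEFin.
have cesE n : cesaro_mean F mu n U = (\int[mu]_y (h n y)%:E)%E.
  rewrite /cesaro_mean; under eq_integral do rewrite hE.
  rewrite ge0_integralZl_EFin ?invr_ge0//; last first.
  - by apply: emeasurable_sum => i; exact/measurable_EFinP/measurable_indic.
  - by move=> y _; apply: sume_ge0 => i _; rewrite lee_fin.
  rewrite ge0_integral_sum//; last first.
    by move=> i; exact/measurable_EFinP/measurable_indic.
  by congr (_ * _)%E; apply: eq_bigr => i _; rewrite integral_indic// setIT.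
have hcvg : {ae mu, forall y, cvgn (h^~ y)}.
  have [M UM] := clopen_uniform finA cU.
  apply: filterS ae_window_eventually_periodic => y /(_ M)[N [p [p0 per]]].
  apply: (cvg_cesaro_eventually_periodic (u := fun i => \1_U (iter i F y))).
  exists N, p; split=> // i Ni; have Uper := UM _ _ (per i Ni).
  rewrite !indicE (_ : (iter (i + p) F y \in U) = (iter i F y \in U))//.
  by apply/idP/idP => /set_mem Uy; apply: mem_set; apply/Uper.
(* The limit of [h] exists only almost everywhere; the upper limit agrees with it there and is
   measurable on the whole space. *)
pose f y := limn_esup (fun n => (h n y)%:E).
have [|||||_ _ cvgh] := dominated_convergence (mu := mu) (D := setT)
    measurableT (f_ := fun n y => (h n y)%:E) (f := f) (g := cst 1%E).
- by move=> n; exact/measurable_EFinP.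
- by apply: measurable_fun_limn_esup => n; exact/measurable_EFinP.
- apply: filterS hcvg => y hy _.
  have ehy : cvgn (fun n => (h n y)%:E).
    by apply/cvg_ex; exists (limn (h^~ y))%:E; apply: cvg_EFin => //; exact: nearW.
  by rewrite /f is_cvg_limn_esupE.
- exact: finite_measure_integrable_cst.
- apply: nearW => y n _; rewrite lee_fin ger0_norm; last first.
    by rewrite mulr_ge0 ?invr_ge0// sumr_ge0.
  have [->|n0] := posnP n; first by rewrite /h invr0 mul0r ler01.
  rewrite /h /= mulrC ler_pdivrMr ?ltr0n// mul1r.
  have -> : n%:R = \sum_(i < n) 1 :> R by rewrite sumr_const card_ord.
  by apply: ler_sum => i _; rewrite indicE; case: (_ \in _).
by apply/cvg_ex; eexists; under eq_fun do rewrite cesE; exact: cvgh.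
Qed.

End almost_equicontinuity.

(** * The algebra of clopen sets generates the Borel sets *)

Section config_borel.
Variable A : pointedType.

Definition clopen_display : measure_display. Proof. exact. Qed.

(* A copy of [config A] whose measurable sets are only the clopen sets. *)
Definition clopen_config : Type := config A.

HB.instance Definition _ := Pointed.on clopen_config.
HB.instance Definition _ := isAlgebraOfSets.Build clopen_display clopen_config
  (@clopen0 (config A)) (@clopenU (config A)) (fun U => @clopenC (config A) U U).

(** Such a set is a union of cylinders, hence open, and its complement is of the same kind by
    symmetry of [C_ n]. *)
Lemma C_saturated_clopen n (U : set (config A)) :
  (forall y z, C_ n y z -> U y -> U z) -> clopen U.
Proof.
have sat_open (V : set (config A)) :
    (forall y z, C_ n y z -> V y -> V z) -> open V.
  move=> satV; rewrite openE => x Vx; apply: (@filterS _ (nbhs x) _ (C_ n x)).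
    by move=> y xy; exact: satV xy Vx.
  by apply: open_nbhs_nbhs; split; [exact: C_open|exact: C_refl].
move=> satU; split; first exact: sat_open.
rewrite -[U]setCK; apply: open_closedC; apply: sat_open => y z yz.
by apply: contra_not => Uz; apply: (satU z y) => //; exact: C_sym.
Qed.

Lemma measurable_config_clopen :
  (@measurable _ (config A)) = <<s @clopen (config A) >>.
Proof.
apply/seteqP; split; last first.
  apply: smallest_sub; first exact: sigma_algebra_measurable.
  by move=> U; exact: clopen_config_measurable.
apply: smallest_sub; first exact: smallest_sigma_algebra.
(* An open set is the countable union of the sets [V n], each clopen because it is a union of
   [n]-cylinders. *)
move=> U oU; pose V n := [set x | C_ n x `<=` U].
rewrite (_ : U = \bigcup_n V n).
  apply: sigma_algebra_bigcup => n; apply: sub_sigma_algebra.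
  apply: (@C_saturated_clopen n) => y z yz yU w zw.
  by apply: yU; exact: C_trans yz zw.
apply/seteqP; split => [x Ux|x [n _]]; last by apply; exact: C_refl.
have [|n nU] := @nbhs_C_ A x U; first exact: open_nbhs_nbhs.
by exists n.
Qed.

End config_borel.

(** Normalizing a measure of mass 1 does not change it; the Dirac measure is only the fallback of
    [mnormalize] for mass 0 or infinity. *)
Lemma probability_of_measure d (T : measurableType d) (R : realType)
    (m : {measure set T -> \bar R}) : m setT = 1%E ->
  exists P : probability T R, forall B, P B = m B.
Proof.
move=> m1; exists (mnormalize m (dirac point)) => B /=.
by rewrite /mnormalize m1 eqe oner_eq0/= invr1 mule1.
Qed.

(** * Extension of a limit on clopen sets to a Borel probability *)

Section clopen_limit.
Variables (A : pointedType) (R : realType).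
Hypothesis finA : finite_set [set: A].
Variable P : nat -> probability (config A) R.
Hypothesis cvgP : forall U, clopen U -> cvgn (fun n => P n U).

Definition clopen_limit (U : set (clopen_config A)) : \bar R :=
  limn (fun n => P n U).

Let cvg_clopen_limit U : clopen U -> P n U @[n --> \oo] --> clopen_limit U.
Proof. exact: cvgP. Qed.

Let clopen_limit0 : clopen_limit set0 = 0%E.
Proof.
rewrite /clopen_limit; under eq_fun do rewrite measure0.
exact: lim_cst.
Qed.

Let clopen_limit_ge0 U : (0 <= clopen_limit U)%E.
Proof.
rewrite /clopen_limit; have [cU|ncU] := pselect (cvgn (fun n => P n U)).
  by apply: lime_ge => //; exact: nearW.
(* [lim] of a divergent sequence is the junk value 0 *)
by rewrite dvgP.
Qed.

(* By compactness a clopen set is never an infinite disjoint union of nonempty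
   clopen sets, so that finite additivity suffices. *)
Let clopen_limit_sigma_additive : semi_sigma_additive clopen_limit.
Proof.
move=> U cU tU cUU.
have [N UN] : exists N, forall i, (N <= i)%N -> U i = set0.
  have cptU : compact (\bigcup_n U n : set (config A)).
    exact: (subclosed_compact cUU.2 (config_compact finA)).
  move: cptU; rewrite compact_cover => /(_ _ setT U).
  case=> [i _|//|D _ UD]; first exact: (cU i).1.
  (* A set with index beyond the finite subcover [D] is contained in the union of [D] and disjoint
     from its members, hence empty. *)
  exists (\max_(i <- enum_fset D) i).+1 => i Di; apply/seteqP; split=> // x Uix.
  have [j jD Ujx] := UD x (ex_intro2 _ _ i I Uix).
  have ji : (j < i)%N by apply: leq_trans Di; rewrite ltnS; exact: leq_bigmax_seq.
  move/trivIsetP : tU => /(_ i j I I); rewrite gtn_eqF// => /(_ isT) Uij.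
  by rewrite -Uij.
apply: cvg_near_cst; exists N => // n /= Nn.
(* Both sides are limits of [P k] on the union: one through finite additivity of [P k], the other by
   definition. *)
apply: (@cvg_unique _ (@ereal_hausdorff R) (P k (\bigcup_n U n) @[k --> \oo])).
  rewrite (_ : (fun k => _) = fun k => (\sum_(0 <= i < n) P k (U i))%E).
    apply: cvg_nnesum => i _; first exact: nearW.
    exact: cvg_clopen_limit (cU i).
  apply/funext => k; rewrite big_mkord.
  have mU i : measurable (U i : set (config A)).
    by apply: clopen_config_measurable; exact: cU.
  rewrite -(measure_bigsetU (P k) mU tU); congr (P k _).
  rewrite -bigcup_mkord; apply/seteqP; split=> x [i _ Uix]; last by exists i.
  exists i => //=; rewrite ltnNge; apply/negP => /(leq_trans Nn) /UN Ui0.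
  by rewrite Ui0 in Uix.
exact: cvg_clopen_limit.
Qed.

HB.instance Definition _ := isMeasure.Build _ _ _ clopen_limit
  clopen_limit0 clopen_limit_ge0 clopen_limit_sigma_additive.

Lemma probability_clopen_limit : exists Q : probability (config A) R,
  forall U, clopen U -> P n U @[n --> \oo] --> Q U.
Proof.
pose m : {measure set _ -> \bar R} := measure_extension clopen_limit.
have mE U : clopen U -> m U = clopen_limit U.
  by move=> cU; exact: measurable_mu_extE.
have [|Q0 Q0E] := @probability_of_measure _ _ _ m.
  rewrite mE; last exact: clopenT.
  rewrite /clopen_limit; under eq_fun do rewrite probability_setT.
  exact: lim_cst.
(* The extension lives on the sigma-algebra generated by the clopen algebra. Its image under the
   identity is the same measure on the Borel sets. *)
pose T0 := g_sigma_algebraType (@measurable _ (clopen_config A)).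
have mid : measurable_fun setT (id : T0 -> config A).
  by move=> _ B mB; rewrite setTI preimage_id; move: mB; rewrite measurable_config_clopen.
exists (distribution Q0 (mfun_Sub (mem_set mid))) => U cU.
rewrite /= /distribution /pushforward preimage_id Q0E mE//.
exact: cvg_clopen_limit.
Qed.

End clopen_limit.

(** Clopen sets form a pi-system generating the Borel sets. *)
Lemma eq_probability_clopen (A : pointedType) (R : realType)
    (P Q : probability (config A) R) : (forall U, clopen U -> P U = Q U) ->
  forall B, measurable B -> P B = Q B.
Proof.
move=> PQ B mB; apply: (@measure_unique _ R (config A)
  (@clopen (config A)) (fun=> setT)) => //.
- exact: measurable_config_clopen.
- exact: clopenI.
- by move=> _; exact: clopenT.
- by apply/seteqP; split=> // x _; exists 0%N.
- by move=> _; rewrite [X in (X < _)%E]probability_setT ltry.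
Qed.

(** * From clopen sets to continuous test functions *)

Section clopen_vague.
Variables (A : pointedType) (R : realType).
Hypothesis finA : finite_set [set: A].
Implicit Types (P Q : probability (config A) R) (f g : config A -> R).

(** A canonical point of the [n]-cylinder of [x]: composing a function with [window n] makes it a
    step function on cylinders. *)
Definition window (n : nat) (x : config A) : config A :=
  fun i => if - n%:Z <= i <= n%:Z then x i else point.

Lemma window_C_ n x : C_ n (window n x) x.
Proof. by move=> i ni; rewrite /window ni. Qed.

Lemma eq_window n x y : C_ n x y -> window n x = window n y.
Proof.
by move=> xy; apply/funext => i; rewrite /window; case: ifP => // /xy ->.
Qed.

Lemma finite_range_window n : finite_set (range (window n)).
Proof.
have := config_compact finA.
rewrite compact_cover => /(_ _ setT (fun x => C_ n x)).
case=> [x _|x _|D _ DT]; first exact: C_open.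
  by exists x => //; exact: C_refl.
apply: (@sub_finite_set _ _ (window n @` [set` D])); last first.
  by apply: finite_image; exact: finite_fset.
by move=> _ [x _ <-]; have [y yD yx] := DT x I; exists y => //; exact: eq_window.
Qed.

(** The cylinders around the points of the range partition the space, so only the term
    [t = window n x] survives. *)
Lemma windowE f n x : f (window n x) =
  \sum_(t <- fset_set (range (window n))) f t * \1_(C_ n t) x.
Proof.
rewrite (bigD1_seq (window n x))//=; last 2 first.
- rewrite in_fset_set; last exact: finite_range_window.
  by apply: mem_set; exists x.
- exact: fset_uniq.
rewrite indicE mem_set ?mulr1; last exact: window_C_.
rewrite big_seq_cond big1 ?addr0// => t /andP[].
rewrite in_fset_set; last exact: finite_range_window.
move=> /set_mem[y _ <-] yx; rewrite indicE memNset ?mulr0// => xy.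
move/eqP : yx; apply; apply: eq_window => i ni.
by rewrite (xy i ni) /window ni.
Qed.

Lemma continuous_config_integrable P f : continuous f ->
  P.-integrable setT (EFin \o f).
Proof.
move=> cf; apply: measurable_bounded_integrable => //.
- by rewrite [X in (X < _)%E]probability_setT ltry.
- exact: continuous_config_measurable_real.
have : bounded_set (f @` setT).
  apply: compact_bounded; apply: continuous_compact (config_compact finA).
  exact: continuous_subspaceT.
move=> [M [Mr MP]]; exists M; split=> // y My x _ /=.
by apply: (MP y My); exists x.
Qed.

(** Whatever [f] is, [f \o window n] is locally constant, hence continuous. *)
Lemma window_integrable P f n : P.-integrable setT (EFin \o (f \o window n)).
Proof.
apply: continuous_config_integrable; move=> x U /nbhs_singleton Ux.
apply: (@filterS _ (nbhs x) _ (C_ n x)) => [y xy /=|].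
  by rewrite -(eq_window xy).
by apply: open_nbhs_nbhs; split; [exact: C_open|exact: C_refl].
Qed.

Lemma Rintegral_window P f n : \int[P]_x f (window n x) =
  \sum_(t <- fset_set (range (window n))) f t * fine (P (C_ n t)).
Proof.
have intC t : P.-integrable setT (fun x => (\1_(C_ n t) x)%:E).
  by apply: integrable_indic => //; exact: C_measurable.
rewrite /Rintegral.
under eq_integral do rewrite windowE -sumEFin.
rewrite integral_sum//; last first.
  by move=> t; under eq_fun do rewrite EFinM; exact: integrableZl.
rewrite (eq_bigr (fun t => (f t * fine (P (C_ n t)))%:E)) ?sumEFin// => t _.
under eq_integral do rewrite EFinM.
rewrite integralZl// integral_indic// ?setIT; last exact: C_measurable.
by rewrite EFinM fineK// fin_num_measure//; exact: C_measurable.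
Qed.

Lemma dist_Rintegral_le P f g (e : R) :
  P.-integrable setT (EFin \o f) -> P.-integrable setT (EFin \o g) ->
  (forall x, `|f x - g x| <= e) -> `|\int[P]_x f x - \int[P]_x g x| <= e.
Proof.
move=> intf intg fge; rewrite -RintegralB//.
have intfg : P.-integrable setT (EFin \o (fun x => f x - g x)).
  rewrite (_ : _ \o _ = (fun x => (EFin \o f) x - (EFin \o g) x)%E)//.
  exact: integrableB.
apply: (le_trans (le_normr_Rintegral _ intfg)) => //.
have -> : e = \int[P]_(x in setT) e.
  by rewrite Rintegral_cst//= [fine _](_ : _ = 1) ?mulr1// probability_setT.
apply: le_Rintegral => //; first exact: (integrable_norm intfg).
exact: finite_measure_integrable_cst.
Qed.

(** An [e / 3] argument: [f] is within [e / 3] of [f \o window n], so their integrals are that close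
    for every probability at once, and the integral of the latter is a finite combination of masses
    of cylinders. *)
Lemma cvg_clopen_vague (P : nat -> probability (config A) R) Q f :
  (forall U, clopen U -> P n U @[n --> \oo] --> Q U) -> continuous f ->
  (\int[P n]_x (f x)%:E)%E @[n --> \oo] --> (\int[Q]_x (f x)%:E)%E.
Proof.
move=> PQ cf.
have intf (P' : probability (config A) R) := continuous_config_integrable P' cf.
have finI (P' : probability (config A) R) : (\int[P']_x (f x)%:E)%E \is a fin_num.
  exact: integrable_fin_num (intf P').
rewrite -(fineK (finI Q)); apply/fine_cvgP; split; first exact: nearW.
apply/cvgrPdist_le => e e0; have e3 : 0 < e / 3 by rewrite divr_gt0.
have [|n nf] := @uniformly_C_ A finA (fun y z => `|f y - f z| <= e / 3).
  (* Two points of [C_ n x] are compared through [x], which doubles [e / 6]. *)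
  move=> x; have e6 : 0 < e / 6 by rewrite divr_gt0.
  have /nbhs_C_[n nx] : nbhs x (f @^-1` [set r | `|f x - r| <= e / 6]).
    by have /cvgrPdist_le := cf x; exact.
  exists n => y z /nx /= xy /nx /= xz; rewrite (le_trans (ler_distD (f x) _ _))//.
  by rewrite distrC (le_trans (lerD xy xz))//; lra.
have close (P' : probability (config A) R) :
    `|\int[P']_x f x - \int[P']_x f (window n x)| <= e / 3.
  apply: dist_Rintegral_le (intf P') (window_integrable P' f n) _ => x.
  by apply: nf => i ni; rewrite /window ni.
have cvgw : \int[P k]_x f (window n x) @[k --> \oo] --> \int[Q]_x f (window n x).
  rewrite Rintegral_window; under eq_fun do rewrite Rintegral_window.
  elim: (enum_fset _) => [|t s IHs].
    by rewrite big_nil; under eq_fun do rewrite big_nil; exact: cvg_cst.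
  rewrite big_cons; pose u k := \sum_(t' <- s) f t' * fine (P k (C_ n t')).
  apply: (@cvg_trans _ ((fun k => f t * fine (P k (C_ n t)) + u k) @ \oo)).
    by apply: near_eq_cvg; apply: nearW => k; rewrite big_cons.
  apply: cvgD => //; apply: cvgM; first exact: cvg_cst.
  apply: fine_cvg; rewrite fineK ?fin_num_measure//; last exact: C_measurable.
  by apply: PQ; exact: clopen_C_.
move/cvgrPdist_le : cvgw => /(_ _ e3); apply: filterS => k Qk /=.
have := close Q; have := close (P k); rewrite /Rintegral in Qk *.
set a := fine _ in Qk *; set b := fine _ in Qk *.
rewrite !ler_norml => /andP[? ?] /andP[? ?]; move: Qk; rewrite !ler_norml => /andP[? ?].
by apply/andP; split; lra.
Qed.

End clopen_vague.

(** * Cesaro means as probabilities, and their near invariance *)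

Section cesaro_measures.
Variables (A : pointedType) (R : realType) (F : config A -> config A).
Hypothesis cF : continuous F.
Variable mu : probability (config A) R.

(** The index is [n.+1] because the mean of index 0 is the zero measure. *)
Lemma cesaro_probability n : exists P : probability (config A) R,
  P = cesaro_mean F mu n.+1 :> (set (config A) -> \bar R).
Proof.
have mF i : measurable_fun setT (iter i F).
  by apply: continuous_config_measurable; exact: iter_continuous.
have n0 : 0 <= n.+1%:R^-1 :> R by rewrite invr_ge0.
pose m : {measure set (config A) -> \bar R} := mscale (NngNum n0)
  (msum (fun i => distribution mu (mfun_Sub (mem_set (mF i)))) n.+1).
have mE B : m B = cesaro_mean F mu n.+1 B by [].
have [|P PE] := probability_of_measure (m := m); last first.
  by exists P; apply/funext => B; rewrite PE.
rewrite mE /cesaro_mean (eq_bigr (fun=> 1%E)); last first.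
  by move=> i _; rewrite /pushforward preimage_setT probability_setT.
by rewrite sumEFin sumr_const card_ord -EFinM mulVf.
Qed.

(** The difference of the two sums telescopes to [a n.+1 - a 0], a difference of two numbers in the
    unit interval. *)
Lemma cesaro_mean_preimageB n (U : set (config A)) : measurable U ->
  `|fine (cesaro_mean F mu n.+1 (F @^-1` U)) - fine (cesaro_mean F mu n.+1 U)|
    <= n.+1%:R^-1.
Proof.
move=> mU; pose a i := fine (mu (iter i F @^-1` U)).
have mFU i : measurable (iter i F @^-1` U).
  rewrite -[X in measurable X]setTI.
  by apply: continuous_config_measurable mU => //; exact: iter_continuous.
have aE i : mu (iter i F @^-1` U) = (a i)%:E by rewrite fineK// fin_num_measure.
have a01 i : 0 <= a i <= 1.
  by rewrite fine_ge0//= -lee_fin -aE probability_le1.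
have sumE (k : nat) : fine (cesaro_mean F mu n.+1 (iter k F @^-1` U)) =
    n.+1%:R^-1 * \sum_(i < n.+1) a (i + k)%N.
  rewrite /cesaro_mean (eq_bigr (fun i : 'I__ => (a (i + k)%N)%:E)) ?sumEFin//.
  move=> i _; rewrite /pushforward -aE; congr (mu _).
  by apply/seteqP; split=> y /=; rewrite addnC iterD.
rewrite (sumE 1%N) (sumE 0%N) -mulrBr normrM ger0_norm ?invr_ge0//.
rewrite ler_piMr ?invr_ge0//; under eq_bigr do rewrite addn1.
under [X in _ - X]eq_bigr do rewrite addn0.
rewrite -sumrB -(big_mkord xpredT (fun i => a i.+1 - a i)) telescope_sumr//.
have /andP[? ?] := a01 0%N; have /andP[? ?] := a01 n.+1.
by rewrite ler_norml; apply/andP; split; lra.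
Qed.

End cesaro_measures.

Theorem theorem1 (A : pointedType) (finA : finite_set [set: A]%classic)
    (R : realType) (F : config A -> config A) (caF : cellular_automaton F)
    (mu : probability (config A) R)
    (erg_mu : ergodic_measure (@shift_map A) mu)
    (exF : exists x : config A, almost_equicontinuous_point mu F x) :
  exists mu_c : probability (config A) R,
    invariant_measure F mu_c /\ vague_cvg (cesaro_mean F mu) mu_c.
Proof.
have [x eqx] := exF; have cF := caF.1.
have /choice[P PE] := cesaro_probability cF mu.
have cvgP U : clopen U -> cvgn (fun n => P n U).
  move=> cU; have [l cl] := (cvg_ex _).1 (cvg_cesaro_clopen erg_mu finA caF eqx cU).
  (* [P n] is the mean of index [n.+1], so the sequence is shifted by one. *)
  apply/cvg_ex; exists l; move: cl; rewrite -cvg_shiftS; apply: cvg_trans.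
  by apply: near_eq_cvg; apply: nearW => n; rewrite /= PE.
have [mu_c mu_cP] := probability_clopen_limit finA cvgP.
exists mu_c; split.
  have mF := continuous_config_measurable cF.
  (* Invariance is the equality of [mu_c] with its image under [F], tested on clopen sets. *)
  apply: (eq_probability_clopen (P := distribution mu_c (mfun_Sub (mem_set mF)))).
  move=> U cU; rewrite /= /distribution /pushforward /=.
  have cFU : clopen (F @^-1` U) by exact: preimage_clopen.
  have finP (Q : probability (config A) R) V : clopen V -> Q V \is a fin_num.
    by move=> cV; apply: fin_num_measure; exact: clopen_config_measurable.
  have fineP V : clopen V -> fine (P n V) @[n --> \oo] --> fine (mu_c V).
    by move=> cV; apply: fine_cvg; rewrite fineK ?finP//; exact: mu_cP.
  rewrite -(fineK (finP _ _ cU)) -(fineK (finP _ _ cFU)); congr (_%:E).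
  apply/eqP; rewrite -subr_eq0 -normr_eq0; apply/eqP.
  (* These distances tend to the distance between [mu_c] of the preimage and [mu_c U], and also to
     0, being at most [1 / n.+1]. *)
  apply: (@cvg_unique _ (@Rhausdorff R)
    (`|fine (P n (F @^-1` U)) - fine (P n U)| @[n --> \oo])).
    by apply: cvg_norm; apply: cvgB; exact: fineP.
  apply: (squeeze_cvgr (f := fun=> 0) (h := fun n => n.+1%:R^-1)).
  - apply: nearW => n; rewrite normr_ge0/= !PE.
    by apply: cesaro_mean_preimageB => //; exact: clopen_config_measurable.
  - exact: cvg_cst.
  - exact: cvg_harmonic.
move=> f cf _; rewrite -cvg_shiftS.
apply: (cvg_trans _ (cvg_clopen_vague finA mu_cP cf)).
by apply: near_eq_cvg; apply: nearW => n; rewrite /= PE.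
Qed.
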